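(* Let $W$ be an even weight function on the unit circle (that is, $W:\mathbb{R}\to[0,\infty)$ is $2\pi$-periodic, Lebesgue integrable on $[-\pi,\pi]$, satisfies $\int_{-\pi}^{\pi}W(\theta)\,d\theta>0$, and $W(-\theta)=W(\theta)$), and let $\{\phi_j\}_{j\ge 0}$ be the orthogonal polynomials on the unit circle associated to $W$. Let $n\ge 0$ be a fixed integer and let $$P_n(z)=\sum_{j=0}^n\eta_j\phi_j(z),\qquad \eta_j=\alpha_j+i\beta_j,$$ where $\alpha_0,\dots,\alpha_n,\beta_0,\dots,\beta_n$ are independent real standard normal random variables. Let $h_n^P$ be the intensity function of the zeros of $P_n$. Then for every $z\in\mathbb{C}$ with $|z|\neq 1$, $$h_n^P(z)=\frac{1}{\pi\left(1-|z|^2\right)^2}\left(1-\frac{\left(1-|z|^2\right)^2\left|\phi_{n+1}^{*}(z)\,\phi_{n+1}'(z)-(\phi_{n+1}^{*})'(z)\,\phi_{n+1}(z)\right|^2}{\left(\left|\phi_{n+1}^{*}(z)\right|^2-\left|\phi_{n+1}(z)\right|^2\right)^2}\right),$$ where $\phi_{m}^{*}(z)=z^{m}\,\overline{\phi_{m}\left(1/\bar z\right)}$.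
   Context: Orthogonal polynomials on the unit circle (OPUC) associated to a weight $W$: the unique polynomials $\phi_0,\phi_1,\phi_2,\dots$ such that $\phi_m$ has exact degree $m$ with real positive leading coefficient and $$\frac{1}{2\pi}\int_{-\pi}^{\pi}W(\theta)\,\phi_m(e^{i\theta})\,\overline{\phi_k(e^{i\theta})}\,d\theta=\delta_{mk}\qquad\text{for all } m,k\in\mathbb{N}\cup\{0\}.$$ When $W$ is even, all the $\phi_j$ have real coefficients. The polynomial $\phi_m^*(z)=z^m\overline{\phi_m(1/\bar z)}$ is the reversed polynomial of $\phi_m$ (extended to $z=0$ as a polynomial). Intensity function: for a Jordan region $\Omega\subset\mathbb{C}$ (the interior of a Jordan curve), $N_n(\Omega)$ denotes the random number of zeros of $P_n$ in $\Omega$, and $\mathbb{E}$ denotes expectation. The intensity function $h_n^P$ is the density for the expected number of zeros, i.e. $\mathbb{E}[N_n(\Omega)]=\int_\Omega h_n^P(x+iy)\,dx\,dy$ for every Jordan region $\Omega$. By a previously known result, this density is given (and its pointwise values are understood to be given) by $$h_n^P(z)=\frac{K_n^{(1,1)}(z,z)\,K_n(z,z)-\left|K_n^{(0,1)}(z,z)\right|^2}{\pi\,\left(K_n(z,z)\right)^2},$$ where $K_n(z,w)=\sum_{j=0}^n\phi_j(z)\overline{\phi_j(w)}$, $K_n^{(0,1)}(z,w)=\sum_{j=0}^n\phi_j(z)\overline{\phi_j'(w)}$, and $K_n^{(1,1)}(z,w)=\sum_{j=0}^n\phi_j'(z)\overline{\phi_j'(w)}$. (Here $K_n(z,z)\ge|\phi_0|^2>0$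 for every $z$.) *)

(* Defs.v *)
From mathcomp Require Export all_boot all_order all_algebra.
From mathcomp Require Export complex.
From mathcomp Require Export all_classical all_reals all_analysis.

Set Implicit Arguments.
Unset Strict Implicit.
Unset Printing Implicit Defensive.

Export Order.TTheory GRing.Theory Num.Theory numFieldNormedType.Exports.

(* complex_scope also has a notation ^*; with ring_scope on top it is Num.conj. *)
Global Open Scope classical_set_scope.
Global Open Scope complex_scope.
Global Open Scope ring_scope.

Record even_weight (R : realType) (W : R -> R) : Prop := EvenWeight {
  weight_ge0 : forall t, 0 <= W t ;
  weight_periodic : forall t, W (t + 2 * pi) = W t ;
  weight_integrable :
    (@lebesgue_measure R).-integrable `[- pi, pi] (EFin \o W) ;
  weight_mass : 0 < \int[@lebesgue_measure R]_(t in `[- pi, pi]) W t ;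
  weight_even : forall t, W (- t) = W t }.

Definition complex_integral (R : realType) (D : set R) (f : R -> R[i]) : R[i] :=
  (\int[@lebesgue_measure R]_(t in D) complex.Re (f t)) +i*
  (\int[@lebesgue_measure R]_(t in D) complex.Im (f t)).

Definition expi (R : realType) (t : R) : R[i] := cos t +i* sin t.

(* In R[i] the order is partial and 0 < x entails that x is real. *)
Record opuc (R : realType) (W : R -> R) (phi : nat -> {poly R[i]}) : Prop :=
  Opuc {
  opuc_degree : forall m, size (phi m) = m.+1 ;
  opuc_lead_coef : forall m, 0 < lead_coef (phi m) ;
  opuc_orthonormal : forall m k,
    ((2 * pi)^-1)%:C *
      complex_integral `[- pi, pi]
        (fun t => (W t)%:C * (phi m).[expi t] * ((phi k).[expi t])^*)
    = (m == k)%:R }.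

(* The polynomial z |-> z ^+ m * (p.[1 / z^*])^* for p of degree at most m,
   see horner_reversed. *)
Definition reversed (R : realType) (m : nat) (p : {poly R[i]}) : {poly R[i]} :=
  \poly_(i < m.+1) (p`_(m - i))^*.

Lemma horner_reversed (R : realType) (m : nat) (p : {poly R[i]}) (z : R[i]) :
  (size p <= m.+1)%N -> z != 0 ->
  (reversed m p).[z] = z ^+ m * (p.[1 / z^*])^*.
Proof.
move=> sp z0; rewrite horner_poly (horner_coef_wide _ sp) rmorph_sum mulr_sumr.
rewrite (reindex_inj rev_ord_inj) /=; apply: eq_bigr => i _.
have im : (i <= m)%N by rewrite -ltnS.
rewrite subSS subKn // mul1r -fmorphV rmorphM -rmorphXn /= conjCK.
rewrite mulrCA; congr (_ * _).
by rewrite exprVn -expfB_cond ?(negbTE z0).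
Qed.

Section kernels.
Context (R : realType) (phi : nat -> {poly R[i]}) (n : nat).

Definition kernel00 (z w : R[i]) : R[i] :=
  \sum_(j < n.+1) (phi j).[z] * ((phi j).[w])^*.

Definition kernel01 (z w : R[i]) : R[i] :=
  \sum_(j < n.+1) (phi j).[z] * ((phi j)^`().[w])^*.

Definition kernel11 (z w : R[i]) : R[i] :=
  \sum_(j < n.+1) (phi j)^`().[z] * ((phi j)^`().[w])^*.

End kernels.

(* Interiors of Jordan curves, the plane being R * R: the bounded connected
   component of the complement of a simple closed curve. *)
Definition jordan_region (R : realType) (O : set (R * R)) : Prop :=
  exists g : R -> R * R,
    [/\ {within `[0, 1], continuous g}, g 0 = g 1,
        {in `[0, 1[ &, injective g} &
        exists2 x, (~` (g @` `[0, 1])) x &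
          O = connected_component (~` (g @` `[0, 1])) x /\ bounded_set O].

(* Zeros are counted with multiplicity; mup x 0 is 0. *)
Definition zero_count (R : realType) (p : {poly R[i]}) (O : set (R * R)) :
    \bar R :=
  \esum_(x in O) (mup (x.1 +i* x.2) p)%:R%:E.

Definition mutually_independent (d : measure_display) (T : measurableType d)
    (R : realType) (P : probability T R) (I : finType) (X : I -> {RV P >-> R}) :
    Prop :=
  forall (J : {set I}) (A : I -> set R), (forall i, measurable (A i)) ->
    P (\bigcap_(i in [set` J]) (X i @^-1` A i)) =
    (\prod_(i in J) P (X i @^-1` A i))%E.

Definition standard_normal (d : measure_display) (T : measurableType d)
    (R : realType) (P : probability T R) (X : {RV P >-> R}) : Prop :=
  forall A : set R, measurable A -> distribution P X A = normal_prob 0 1 A.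

Definition random_poly (d : measure_display) (T : measurableType d)
    (R : realType) (P : probability T R) (phi : nat -> {poly R[i]}) (n : nat)
    (alpha beta : 'I_n.+1 -> {RV P >-> R}) (omega : T) : {poly R[i]} :=
  \sum_(j < n.+1) (alpha j omega +i* beta j omega) *: phi j.

(* h is a density of the expected number of zeros of the random polynomial;
   since this determines h only almost everywhere, its pointwise values are
   fixed to be those of the kernel formula. *)
Record intensity_function (d : measure_display) (T : measurableType d)
    (R : realType) (P : probability T R) (phi : nat -> {poly R[i]}) (n : nat)
    (alpha beta : 'I_n.+1 -> {RV P >-> R}) (h : R[i] -> R) : Prop :=
  IntensityFunction {
  intensity_density : forall O : set (R * R), jordan_region O ->
    (\int[P]_omega zero_count (random_poly phi alpha beta omega) O =
     \int[(@lebesgue_measure R \x @lebesgue_measure R)]_(x in O)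
        (h (x.1 +i* x.2))%:E)%E ;
  intensity_value : forall z : R[i],
    (h z)%:C =
    (kernel11 phi n z z * kernel00 phi n z z - `|kernel01 phi n z z| ^+ 2) /
    ((@pi R)%:C * kernel00 phi n z z ^+ 2) }.

(* Main.v *)
Require Import Defs.
From mathcomp Require Import ring.

(* The heart of the matter is the Christoffel-Darboux formula
     (1 - z w^* ) K_n(z, w) = qs(z) qs(w)^* - q(z) q(w)^*,
   with q = phi_{n+1} and qs its reversal: multiplication by z and reversal
   are isometries on the circle, so both phi_0, ..., phi_{n+1} and
   z phi_0, ..., z phi_n, qs are orthonormal bases of the polynomials of degree
   at most n + 1, and the kernel sum does not depend on the orthonormal basis.
   Differentiating the formula in z and in w^* then expresses the determinant
   K^(1,1) K - |K^(0,1)|^2 through |qs q' - qs' q|^2. *)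

Set Implicit Arguments.
Unset Strict Implicit.
Unset Printing Implicit Defensive.

(** * Orthonormal bases and kernel sums for an abstract Hermitian form *)

Section OrthonormalPolynomials.
Context (C : numClosedFieldType) (ip : {poly C} -> {poly C} -> C).
Hypothesis ip_linearl :
  forall a (p q r : {poly C}), ip (a *: p + q) r = a * ip p r + ip q r.
Hypothesis ip_conj : forall p q, (ip p q)^* = ip q p.

Lemma ip_suml (I : finType) (a : I -> C) (p : I -> {poly C}) (r : {poly C}) :
  ip (\sum_i a i *: p i) r = \sum_i a i * ip (p i) r.
Proof.
elim/big_rec2: _ => [|i x y _ <-]; last by rewrite ip_linearl.
(* The empty sum requires [ip 0 r = 0]: at [a = -1] linearity makes it [- ip 0 r + ip 0 r]. *)
by have := ip_linearl (-1) 0 0 r; rewrite scaler0 addr0 mulN1r addNr.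
Qed.

Lemma ip_sumr (I : finType) (a : I -> C) (p : I -> {poly C}) (r : {poly C}) :
  ip r (\sum_i a i *: p i) = \sum_i (a i)^* * ip r (p i).
Proof.
rewrite -ip_conj ip_suml rmorph_sum; apply: eq_bigr => i _ /=.
by rewrite rmorphM /= ip_conj.
Qed.

Context (phi : nat -> {poly C}).
Hypothesis size_phi : forall m, size (phi m) = m.+1.

(** As [phi m] has degree exactly [m], subtracting the right multiple of it cancels the coefficient
    of [p] at [m], and induction applies. *)
Lemma graded_span m (p : {poly C}) : (size p <= m)%N ->
  exists c : nat -> C, p = \sum_(j < m) c j *: phi j.
Proof.
elim: m p => [|m IHm] p sp.
  by exists (fun=> 0); rewrite big_ord0; exact/size_poly_leq0P.
have lead0 : (phi m)`_m != 0.
  have -> : (phi m)`_m = lead_coef (phi m) by rewrite /lead_coef size_phi.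
  by rewrite lead_coef_eq0 -size_poly_eq0 size_phi.
pose a := p`_m / (phi m)`_m.
have [|c cE] := IHm (p - a *: phi m).
  apply/leq_sizeP => j; rewrite leq_eqVlt => /predU1P[<-|mj].
    by rewrite coefB coefZ divfK // subrr.
  by rewrite coefB coefZ !nth_default ?mulr0 ?subr0 ?size_phi ?(leq_trans sp).
exists (fun j => if j == m then a else c j).
rewrite big_ord_recr /= eqxx -[LHS](subrK (a *: phi m)) cE; congr (_ + _).
by apply: eq_bigr => i _; rewrite ltn_eqF.
Qed.

Hypothesis ip_phi : forall m k, ip (phi m) (phi k) = (m == k)%:R.

Lemma fourier_expansion m (p : {poly C}) : (size p <= m)%N ->
  p = \sum_(j < m) ip p (phi j) *: phi j.
Proof.
move=> /graded_span[c pE]; rewrite {1}pE; apply: eq_bigr => i _; congr (_ *: _).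
rewrite pE ip_suml (bigD1 i) //= ip_phi eqxx mulr1 big1 ?addr0 // => j ji.
by rewrite ip_phi (negbTE (ji : (j != i :> nat))) mulr0.
Qed.

Lemma ip_phi_low m (p : {poly C}) : (size p <= m)%N -> ip (phi m) p = 0.
Proof.
move=> sp; rewrite (fourier_expansion sp) ip_sumr big1 // => i _.
by rewrite ip_phi gtn_eqF ?mulr0.
Qed.

(** The matrix [U] of coefficients of [e] in the basis [phi] is unitary and so drops out of the
    kernel sum. That [e] spans is not assumed: it has [m] members, so [U] is square and a one-sided
    inverse is two-sided. *)
Lemma kernel_orthonormal_basis m (e : 'I_m -> {poly C}) :
  (forall i, size (e i) <= m)%N ->
  (forall i j, ip (e i) (e j) = (i == j)%:R) ->
  forall z w, \sum_i (e i).[z] * ((e i).[w])^* =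
              \sum_(j < m) (phi j).[z] * ((phi j).[w])^*.
Proof.
move=> se eE z w.
pose U := \matrix_(i < m, j < m) ip (e i) (phi j).
pose V := \matrix_(i < m, j < m) (U j i)^*.
have UV : U *m V = 1%:M.
  apply/matrixP => i j; rewrite !mxE -eE (fourier_expansion (se j)) ip_sumr.
  by apply: eq_bigr => k _; rewrite !mxE mulrC.
have eU i x : (e i).[x] = \sum_(j < m) U i j * (phi j).[x].
  rewrite {1}(fourier_expansion (se i)) horner_sum.
  by apply: eq_bigr => j _; rewrite hornerZ mxE.
(* [U *m V = 1] says that e is orthonormal; what is needed is [V *m U = 1] *)
have /matrixP VU := mulmx1C UV.
transitivity (\sum_(j < m) \sum_(k < m)
    (V *m U) k j * ((phi j).[z] * ((phi k).[w])^*)).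
  under eq_bigr => i _.
    rewrite !eU rmorph_sum big_distrlr /=; over.
  rewrite exchange_big; apply: eq_bigr => j _ /=.
  rewrite exchange_big; apply: eq_bigr => k _ /=.
  rewrite mxE big_distrl; apply: eq_bigr => i _ /=.
  by rewrite rmorphM !mxE; ring.
apply: eq_bigr => j _; rewrite (bigD1 j) //= big1 => [|k kj].
  by rewrite VU mxE eqxx mul1r addr0.
by rewrite VU mxE (negbTE kj) mul0r.
Qed.

End OrthonormalPolynomials.

(** * The weighted inner product on the unit circle and its isometries *)

Section CircleInnerProduct.
Context (R : realType).
Local Notation C := R[i].
Local Notation mu := (@lebesgue_measure R).

Definition complex_integrable (D : set R) (f : R -> C) : Prop :=
  mu.-integrable D (EFin \o (fun t => complex.Re (f t))) /\
  mu.-integrable D (EFin \o (fun t => complex.Im (f t))).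

Lemma complex_integral_linear (D : set R) (c : C) (f g : R -> C) :
  measurable D -> complex_integrable D f -> complex_integrable D g ->
  complex_integral D (fun t => c * f t + g t) =
  c * complex_integral D f + complex_integral D g.
Proof.
move=> mD [fR fI] [gR gI]; case: c => a b; rewrite /complex_integral.
have intZ (r : R) (u : R -> R) : mu.-integrable D (EFin \o u) ->
    mu.-integrable D (EFin \o (fun t => r * u t)) by exact: integrableZl.
have -> : (fun t => complex.Re ((a +i* b) * f t + g t)) = (fun t =>
    a * complex.Re (f t) + (- b) * complex.Im (f t) + complex.Re (g t)).
  by apply/funext => t; case: (f t) (g t) => [u v] [x y] /=; ring.
have -> : (fun t => complex.Im ((a +i* b) * f t + g t)) = (fun t =>
    a * complex.Im (f t) + b * complex.Re (f t) + complex.Im (g t)).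
  by apply/funext => t; case: (f t) (g t) => [u v] [x y] /=; ring.
have intD (u v : R -> R) : mu.-integrable D (EFin \o u) ->
    mu.-integrable D (EFin \o v) ->
    mu.-integrable D (EFin \o (fun t => u t + v t)).
  move=> iu iv; rewrite (_ : _ \o _ = (EFin \o u) \+ (EFin \o v))%E //.
  exact: integrableD.
rewrite !RintegralD ?RintegralZl //; do ?[exact: intZ | apply: intD].
by apply/eqP; rewrite eq_complex /=; apply/andP; split; apply/eqP; ring.
Qed.

Lemma complex_integral_conj (D : set R) (f : R -> C) : measurable D ->
  complex_integrable D f ->
  (complex_integral D f)^* = complex_integral D (fun t => (f t)^*).
Proof.
move=> mD [fR fI].
rewrite /complex_integral.
have -> : (fun t => complex.Re (f t)^*) = (fun t => complex.Re (f t)).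
  by apply/funext => t; case: (f t).
have -> : (fun t => complex.Im (f t)^*) = (fun t => -1 * complex.Im (f t)).
  by apply/funext => t; rewrite mulN1r; case: (f t).
by rewrite RintegralZl // mulN1r.
Qed.

Definition complex_continuous (f : R -> C) : Prop :=
  continuous (fun t => complex.Re (f t)) /\
  continuous (fun t => complex.Im (f t)).

Lemma complex_continuousM f g : complex_continuous f -> complex_continuous g ->
  complex_continuous (fun t => f t * g t).
Proof.
move=> [fR fI] [gR gI]; split=> x.
  under eq_fun => t do
    have -> : complex.Re (f t * g t) = complex.Re (f t) * complex.Re (g t) -
       complex.Im (f t) * complex.Im (g t) by case: (f t) (g t) => [? ?] [? ?].
  by apply: cvgB; apply: cvgM; [exact: fR|exact: gR|exact: fI|exact: gI].
under eq_fun => t do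
  have -> : complex.Im (f t * g t) = complex.Re (f t) * complex.Im (g t) +
     complex.Im (f t) * complex.Re (g t) by case: (f t) (g t) => [? ?] [? ?].
by apply: cvgD; apply: cvgM; [exact: fR|exact: gI|exact: fI|exact: gR].
Qed.

Lemma complex_continuous_horner (p : {poly C}) :
  complex_continuous (fun t => p.[expi t]).
Proof.
elim/poly_ind: p => [|p c IHp].
  by split=> x; under eq_fun do rewrite horner0; exact: cvg_cst.
have expiC : complex_continuous (@expi R).
  by split; [exact: continuous_cos|exact: continuous_sin].
have [pR pI] := complex_continuousM IHp expiC.
split=> x.
  under eq_fun do rewrite hornerMXaddC raddfD /=.
  by apply: cvgD; [exact: pR|exact: cvg_cst].
under eq_fun do rewrite hornerMXaddC raddfD /=.
by apply: cvgD; [exact: pI|exact: cvg_cst].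
Qed.

Context (W : R -> R).
Hypothesis W_integrable : mu.-integrable `[- pi, pi] (EFin \o W).

(** A continuous [g] is bounded on the compact interval, and an integrable function times a bounded
    measurable one is integrable. *)
Lemma weight_continuous_integrable (g : R -> R) : continuous g ->
  mu.-integrable `[- pi, pi] (EFin \o (fun t => W t * g t)).
Proof.
move=> gC; rewrite (_ : _ \o _ = (EFin \o W) \* (EFin \o g))%E //.
apply: integrableMl => //.
  by apply: measurable_funTS; exact: measurable_realfun.continuous_measurable_fun.
have : compact (g @` `[- pi, pi]).
  apply: continuous_compact; last exact: segment_compact.
  exact: continuous_subspaceT.
move=> /compact_bounded[M [M_real gM]]; exists M; split=> // x Mx t tD.
by apply: (gM x Mx); exists t.
Qed.

Lemma weight_complex_integrable (g : R -> C) : complex_continuous g ->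
  complex_integrable `[- pi, pi] (fun t => (W t)%:C * g t).
Proof.
move=> [gR gI]; split.
  rewrite (_ : _ \o _ = EFin \o (fun t => W t * complex.Re (g t))).
    exact: weight_continuous_integrable.
  by apply/funext => t /=; case: (g t) => a b /=; rewrite mul0r subr0.
rewrite (_ : _ \o _ = EFin \o (fun t => W t * complex.Im (g t))).
  exact: weight_continuous_integrable.
by apply/funext => t /=; case: (g t) => a b /=; rewrite mul0r addr0.
Qed.

(** Has the form of the left side of [opuc_orthonormal], so that this field serves directly as the
    hypothesis [ip_phi]. *)
Definition circle_ip (p q : {poly C}) : C :=
  ((2 * pi)^-1)%:C *
  complex_integral `[- pi, pi]
    (fun t => (W t)%:C * p.[expi t] * (q.[expi t])^*).

(** The side condition under which the integral is linear and commutes with conjugation; the factor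
    of [W] is continuous in [t]. *)
Lemma circle_ip_integrable p q :
  complex_integrable `[- pi, pi]
    (fun t => (W t)%:C * p.[expi t] * (q.[expi t])^*).
Proof.
have -> : (fun t => (W t)%:C * p.[expi t] * (q.[expi t])^*) =
    (fun t => (W t)%:C * (p.[expi t] * (q.[expi t])^*)).
  by apply/funext => t; rewrite mulrA.
apply: weight_complex_integrable; apply: complex_continuousM.
  exact: complex_continuous_horner.
have [qR qI] := complex_continuous_horner q; split=> x.
  under eq_fun => t do
    have -> : complex.Re (q.[expi t])^* = complex.Re q.[expi t]
      by case: (q.[_]).
  exact: qR.
under eq_fun => t do
  have -> : complex.Im (q.[expi t])^* = - complex.Im q.[expi t]
    by case: (q.[_]).
by apply: cvgN; exact: qI.
Qed.

Lemma circle_ip_linearl a (p q r : {poly C}) :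
  circle_ip (a *: p + q) r = a * circle_ip p r + circle_ip q r.
Proof.
rewrite /circle_ip mulrCA -mulrDr -complex_integral_linear //.
- congr (_ * complex_integral _ _); apply/funext => t.
  by rewrite hornerD hornerZ; ring.
- exact: circle_ip_integrable.
- exact: circle_ip_integrable.
Qed.

Lemma circle_ip_conj p q : (circle_ip p q)^* = circle_ip q p.
Proof.
have realJ (x : R) : (x%:C)^* = x%:C :> C.
  by apply/eqP; rewrite eq_complex /= oppr0 !eqxx.
rewrite /circle_ip rmorphM /= realJ complex_integral_conj //; last first.
  exact: circle_ip_integrable.
congr (_ * complex_integral _ _); apply/funext => t.
by rewrite !rmorphM /= realJ conjCK; ring.
Qed.

Lemma expi_neq0 (t : R) : expi t != 0.
Proof.
apply/eqP => -[c0 s0]; have := cos2Dsin2 t.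
by rewrite c0 s0 expr0n addr0 => /esym/eqP; rewrite oner_eq0.
Qed.

Lemma expi_mul_conj (t : R) : expi t * (expi t)^* = 1.
Proof.
apply/eqP; rewrite eq_complex /= mulrN opprK -!expr2 cos2Dsin2 eqxx /=.
by rewrite mulrN mulrC addNr.
Qed.

Lemma horner_reversed_circle m (p : {poly C}) (t : R) : (size p <= m.+1)%N ->
  (reversed m p).[expi t] = expi t ^+ m * (p.[expi t])^*.
Proof.
move=> sp; rewrite horner_reversed ?expi_neq0 //; congr (_ * _.[_]^*).
(* On the circle [1 / z^* = z]. *)
by rewrite -(expi_mul_conj t) mulfK // conjC_eq0 expi_neq0.
Qed.

Lemma circle_ip_mulX p q : circle_ip ('X * p) ('X * q) = circle_ip p q.
Proof.
congr (_ * complex_integral _ _); apply/funext => t.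
rewrite !hornerM !hornerX rmorphM /=.
rewrite [LHS](_ : _ = (expi t * (expi t)^*) *
   ((W t)%:C * p.[expi t] * (q.[expi t])^*)); last by ring.
by rewrite expi_mul_conj mul1r.
Qed.

(** On the circle [reversed m p] is the conjugate of [p] times a factor of modulus one, so the two
    integrands agree pointwise. *)
Lemma circle_ip_reversed m (p : {poly C}) : (size p <= m.+1)%N ->
  circle_ip (reversed m p) (reversed m p) = circle_ip p p.
Proof.
move=> sp; congr (_ * complex_integral _ _); apply/funext => t.
rewrite !horner_reversed_circle // rmorphM rmorphXn /= conjCK.
rewrite [LHS](_ : _ = (expi t * (expi t)^*) ^+ m *
   ((W t)%:C * p.[expi t] * (p.[expi t])^*)); last by rewrite exprMn; ring.
by rewrite expi_mul_conj expr1n mul1r.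
Qed.

Lemma circle_ip_mulX_reversed m (p q : {poly C}) : (size p <= m.+1)%N ->
  (size q <= m.+2)%N ->
  circle_ip ('X * p) (reversed m.+1 q) = circle_ip q (reversed m p).
Proof.
move=> sp sq; congr (_ * complex_integral _ _); apply/funext => t.
rewrite hornerM hornerX !horner_reversed_circle //.
rewrite !rmorphM !rmorphXn /= !conjCK.
rewrite [LHS](_ : _ = (expi t * (expi t)^*) *
   ((W t)%:C * q.[expi t] * ((expi t)^* ^+ m * p.[expi t]))).
  by rewrite expi_mul_conj mul1r.
by rewrite exprS; ring.
Qed.

End CircleInnerProduct.

(** * The Christoffel-Darboux formula, its derivatives and the intensity *)

Lemma christoffel_darboux (R : realType) (W : R -> R) (phi : nat -> {poly R[i]})
    (n : nat) : even_weight W -> opuc W phi ->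
  let q := phi n.+1 in
  let qs := reversed n.+1 q in
  forall z w : R[i], (1 - z * w^*) * kernel00 phi n z w =
    qs.[z] * (qs.[w])^* - q.[z] * (q.[w])^*.
Proof.
move=> /weight_integrable intW [size_phi _ ip_phi] q qs z w.
have ipl := circle_ip_linearl intW; have ipJ := circle_ip_conj intW.
pose e (i : 'I_n.+2) := if (i < n.+1)%N then 'X * phi i else qs.
have size_qs : (size qs <= n.+2)%N by exact: size_poly.
have size_e i : (size (e i) <= n.+2)%N.
  rewrite /e; case: ifP => // lt_in.
  by rewrite mulrC size_mulX ?size_phi // -size_poly_eq0 size_phi.
(* The pairing turns into that of [phi n.+1] with a polynomial of degree at most [n]. *)
have ortho (j : nat) : (j < n.+1)%N -> circle_ip W ('X * phi j) qs = 0.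
  move=> lt_jn; rewrite (@circle_ip_mulX_reversed _ _ n) ?size_phi //.
  by rewrite (ip_phi_low ipl ipJ size_phi) //; exact: size_poly.
have ip_e i j : circle_ip W (e i) (e j) = (i == j)%:R.
  rewrite /e; case: ltnP => lt_in; case: ltnP => lt_jn.
  - by rewrite circle_ip_mulX; exact: ip_phi.
  - by rewrite ortho // -val_eqE ltn_eqF // (leq_trans lt_in).
  - by rewrite -ipJ ortho // conjC0 -val_eqE gtn_eqF // (leq_trans lt_jn).
  (* Here both indices equal [n.+1], and [qs] has the norm of [phi n.+1]. *)
  - rewrite circle_ip_reversed ?size_phi // [LHS]ip_phi eqxx.
    rewrite -val_eqE eqn_leq (leq_trans (leq_ord i) lt_jn).
    by rewrite (leq_trans (leq_ord j) lt_in).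
have := kernel_orthonormal_basis ipl ipJ size_phi ip_phi size_e ip_e z w.
have e_max : e ord_max = qs by rewrite /e ltnn.
(* Splitting off the top terms leaves [z w^* K + qs qs^* = K + q q^*], with [K] the kernel up to
   [n]; the claim is a rearrangement. *)
rewrite [LHS]big_ord_recr [RHS]big_ord_recr /= e_max.
rewrite -/(kernel00 phi n z w) -/q.
under eq_bigr => i _ do
  rewrite /e /= ltn_ord !hornerM !hornerX rmorphM /= mulrACA.
rewrite -mulr_sumr -/(kernel00 phi n z w) => eqK.
rewrite mulrBl mul1r -[X in X - _ = _](addrK (q.[z] * (q.[w])^*)) -eqK.
by ring.
Qed.

(** A nonzero difference would have as many distinct roots as its size, taken among the natural
    numbers. It lifts pointwise identities in one variable to polynomial ones, which can be
    differentiated formally. *)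
Lemma horner_ext (F : numDomainType) (p q : {poly F}) :
  (forall x, p.[x] = q.[x]) -> p = q.
Proof.
move=> pq; apply/eqP; rewrite -subr_eq0; apply: contraT => nz.
pose s := [seq i%:R : F | i <- iota 0 (size (p - q))].
have /(max_poly_roots nz) : all (root (p - q)) s.
  by apply/allP => x _; rewrite rootE hornerD hornerN pq subrr.
rewrite map_inj_uniq ?iota_uniq ?size_map ?size_iota ?ltnn => [/(_ isT)//|].
exact: (mulrIn (oner_neq0 F)).
Qed.

Theorem theorem1 (R : realType) (W : R -> R) (phi : nat -> {poly R[i]})
    (n : nat) (d : measure_display) (T : measurableType d)
    (P : probability T R) (alpha beta : 'I_n.+1 -> {RV P >-> R})
    (h : R[i] -> R) :
  even_weight W ->
  opuc W phi ->
  (forall j, standard_normal (alpha j)) ->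
  (forall j, standard_normal (beta j)) ->
  mutually_independent
    (fun s : 'I_n.+1 + 'I_n.+1 =>
       match s with inl j => alpha j | inr j => beta j end) ->
  intensity_function phi alpha beta h ->
  forall z : R[i], `|z| != 1 ->
    let q := phi n.+1 in
    let qs := reversed n.+1 q in
    (h z)%:C =
    ((@pi R)%:C * (1 - `|z| ^+ 2) ^+ 2)^-1 *
    (1 - ((1 - `|z| ^+ 2) ^+ 2 *
          `|qs.[z] * q^`().[z] - qs^`().[z] * q.[z]| ^+ 2) /
         (`|qs.[z]| ^+ 2 - `|q.[z]| ^+ 2) ^+ 2).
Proof.
move=> evenW opucW _ _ _ [_ hE] z z1 q qs; rewrite hE.
have cd := christoffel_darboux n evenW opucW.
have k00_gt0 : 0 < kernel00 phi n z z.
  have phi0_neq0 : (phi 0%N).[z] != 0.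
    have /size_poly1P[c c0 ->] : size (phi 0%N) == 1%N.
      by rewrite (opuc_degree opucW).
    by rewrite hornerC.
  (* The term [j = 0] is the squared modulus of a nonzero constant; the others are nonnegative. *)
  rewrite /kernel00 big_ord_recl -normCK ltr_pwDl ?exprn_gt0 ?normr_gt0 //.
  by apply: sumr_ge0 => j _; rewrite -normCK exprn_ge0.
(* This is K^(1,0)(x, w), the conjugated variable [w] coming first. *)
pose k10 w x := \sum_(j < n.+1) (phi j)^`().[x] * ((phi j).[w])^*.
(* derivative of cd in its first variable *)
have cd10 w x : (1 - x * w^*) * k10 w x - w^* * kernel00 phi n x w =
    qs^`().[x] * (qs.[w])^* - q^`().[x] * (q.[w])^*.
  pose K := \sum_(j < n.+1) ((phi j).[w])^* *: phi j.
  have KE y : K.[y] = kernel00 phi n y w.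
    by rewrite horner_sum; apply: eq_bigr => j _; rewrite hornerZ mulrC.
  have K'E y : K^`().[y] = k10 w y.
    rewrite raddf_sum horner_sum; apply: eq_bigr => j _.
    by rewrite /= derivZ hornerZ mulrC.
  have /(congr1 (fun p => p^`().[x])) :
      (1 - w^* *: 'X) * K = (qs.[w])^* *: qs - (q.[w])^* *: q.
    apply: horner_ext => y; rewrite !hornerE KE mulrC [w^* * y]mulrC.
    by rewrite [LHS]mulrC cd; ring.
  rewrite /= !poly.derivE !hornerE KE K'E => eqK.
  transitivity ((qs.[w])^* * qs^`().[x] - (q.[w])^* * q^`().[x]); last by ring.
  by rewrite -eqK; ring.
have k10E : (k10 z z)^* = kernel01 phi n z z.
  rewrite rmorph_sum; apply: eq_bigr => j _ /=.
  by rewrite rmorphM /= conjCK mulrC.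
(* derivative of the conjugate of cd10 in its second variable *)
have cd11 : (1 - z * z^*) * kernel11 phi n z z - z * k10 z z
    - z^* * kernel01 phi n z z - kernel00 phi n z z =
    qs^`().[z] * (qs^`().[z])^* - q^`().[z] * (q^`().[z])^*.
  pose K := \sum_(j < n.+1) ((phi j).[z])^* *: phi j.
  pose L := \sum_(j < n.+1) ((phi j)^`().[z])^* *: phi j.
  have KE y : K.[y] = (kernel00 phi n z y)^*.
    rewrite horner_sum rmorph_sum; apply: eq_bigr => j _.
    by rewrite hornerZ rmorphM /= conjCK.
  have KzE : K.[z] = kernel00 phi n z z.
    by rewrite horner_sum; apply: eq_bigr => j _; rewrite hornerZ mulrC.
  have K'E : K^`().[z] = k10 z z.
    rewrite raddf_sum horner_sum; apply: eq_bigr => j _.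
    by rewrite /= derivZ hornerZ mulrC.
  have LE y : L.[y] = (k10 y z)^*.
    rewrite horner_sum rmorph_sum; apply: eq_bigr => j _.
    by rewrite hornerZ rmorphM /= conjCK.
  have L'E : L^`().[z] = kernel11 phi n z z.
    rewrite raddf_sum horner_sum; apply: eq_bigr => j _.
    by rewrite /= derivZ hornerZ mulrC.
  (* [cd10 y z] involves [y] only through conjugates, so its conjugate is a polynomial identity in
     [y]. *)
  have /(congr1 (fun p => p^`().[z])) : (1 - z^* *: 'X) * L - 'X * K =
      (qs^`().[z])^* *: qs - (q^`().[z])^* *: q.
    apply: horner_ext => y; have /(congr1 Num.conj) := cd10 y z.
    by rewrite !(rmorphB, rmorphM) rmorph1 /= !conjCK !hornerE KE LE.
  rewrite /= !poly.derivE !hornerE KzE K'E LE k10E L'E => eqK.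
  transitivity ((qs^`().[z])^* * qs^`().[z] - (q^`().[z])^* * q^`().[z]);
    last by ring.
  by rewrite -eqK; ring.
have cd00 := cd z z; rewrite -/q -/qs in cd00.
have cd01 : (1 - z^* * z) * kernel01 phi n z z - z * kernel00 phi n z z =
    (qs^`().[z])^* * qs.[z] - (q^`().[z])^* * q.[z].
  (* Conjugation turns [k10] into [kernel01] and fixes [kernel00], which is real on the diagonal. *)
  have /(congr1 Num.conj) := cd10 z z.
  rewrite !(rmorphB, rmorphM) rmorph1 /= !conjCK k10E.
  by have /CrealP -> := gtr0_real k00_gt0.
have {}cd10 := cd10 z z.
rewrite !normCK -k10E conjCK k10E -cd00.
have s1 : 1 - z * z^* != 0.
  by rewrite -normCK subr_eq0 eq_sym sqrp_eq1.
have pi0 : (@pi R)%:C != 0 by rewrite fmorph_eq0 gt_eqF ?pi_gt0.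
have k0 := lt0r_neq0 k00_gt0.
set D := qs.[z] * _ - _.
have DE : D * D^* = kernel00 phi n z z ^+ 2 - (1 - z * z^*) ^+ 2 *
    (kernel11 phi n z z * kernel00 phi n z z - kernel01 phi n z z * k10 z z).
  (* Lagrange identity for the form [|x|^2 - |y|^2]: the Gram determinant of [(qs, q)] and
     [(qs', q')] is [- D D^*]. *)
  have -> : D * D^* =
      (qs^`().[z] * (qs.[z])^* - q^`().[z] * (q.[z])^*) *
      ((qs^`().[z])^* * qs.[z] - (q^`().[z])^* * q.[z]) -
      (qs^`().[z] * (qs^`().[z])^* - q^`().[z] * (q^`().[z])^*) *
      (qs.[z] * (qs.[z])^* - q.[z] * (q.[z])^*).
    by rewrite /D rmorphB !rmorphM /=; ring.
  by rewrite -cd10 -cd01 -cd11 -cd00; ring.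
rewrite DE; move: (@pi R)%:C pi0 => p p0; field.
by apply/and3P.
Qed.
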